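(* Let $T=[0,T_0]$ (with $T_0>0$) or $T=[0,\infty)$, and let $(u,\beta)$ and $(v,\gamma)$ be solutions to double-obstacle Allen--Cahn (AC) flow on $T$ with $u(0)=v(0)$. Then $u(t)=v(t)$ for all $t\in T$, and $\beta(t)=\gamma(t)$ for a.e. $t\in T$.
   Context: Let $G=(V,E)$ be a finite, undirected, simple, connected graph with symmetric weights $\omega_{ij}=\omega_{ji}$, $\omega_{ij}>0$ for $ij\in E$ and $\omega_{ij}=0$ for $ij\notin E$. Let $d_i=\sum_{j}\omega_{ij}>0$ be the degree of $i\in V$. Fix $r\in[0,1]$ and $\varepsilon>0$. Let $\mathcal V=\{u:V\to\mathbb R\}$ and, for $X\subseteq\mathbb R$, $\mathcal V_X=\{u:V\to X\}$; $\mathcal V$ carries the inner product $\langle u,v\rangle_{\mathcal V}=\sum_{i\in V}u_iv_id_i^r$ with norm $\|\cdot\|_{\mathcal V}$. $\mathbf 1\in\mathcal V$ is the constant function $1$. The graph Laplacian is $(\Delta u)_i=d_i^{-r}\sum_{j\in V}\omega_{ij}(u_i-u_j)$. For an open interval $T$, $H^1(T;\mathcal V)$ is the set of $u\in L^2(T;\mathcal V)$ with generalised (weak) time derivative $du/dt\in L^2(T;\mathcal V)$. For any interval $T$, $H^1_{loc}(T;\mathcal V)$ is the set of $u:T\to\mathcal V$ with $u\in H^1((a,b);\mathcal V)$ for all $a,b\in T$ with $a<b$. For $u\in\mathcal V_{[0,1]}$, $\mathcal B(u)$ is the set of $\alpha\in\mathcal V$ such that for each $i\in V$: $\alpha_i\ge0$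 if $u_i=0$, $\alpha_i=0$ if $0<u_i<1$, and $\alpha_i\le0$ if $u_i=1$. A pair $(u,\beta)$ with $u:T\to\mathcal V_{[0,1]}$, $\beta:T\to\mathcal V$ is a solution to double-obstacle AC flow on an interval $T$ if $u\in H^1_{loc}(T;\mathcal V)\cap C^0(T;\mathcal V)$ and for a.e. $t\in T$, $\varepsilon\frac{du}{dt}+\varepsilon\Delta u(t)+\frac12\mathbf 1-u(t)=\beta(t)$ and $\beta(t)\in\mathcal B(u(t))$. *)

(* Defs.v *)
From HB Require Import structures.
From mathcomp Require Import all_boot all_order all_algebra.
From mathcomp Require Import all_classical all_reals all_analysis.
Set Implicit Arguments.
Unset Strict Implicit.
Unset Printing Implicit Defensive.
Import Order.TTheory GRing.Theory Num.Theory.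
Import numFieldNormedType.Exports.
Local Open Scope classical_set_scope.
Local Open Scope ring_scope.

Record weighted_graph (R : realType) (V : finType) := WeightedGraph {
  vertex_nonempty : (0 < #|V|)%N ;
  edge : rel V ;
  edge_sym : symmetric edge ;
  edge_irr : irreflexive edge ;
  edge_connected : forall i j, connect edge i j ;
  weight : V -> V -> R ;
  weight_sym : forall i j, weight i j = weight j i ;
  weight_gt0 : forall i j, edge i j -> 0 < weight i j ;
  weight_eq0 : forall i j, ~~ edge i j -> weight i j = 0 ;
  degree : V -> R := fun i => \sum_j weight i j ;
  degree_gt0 : forall i, 0 < degree i }.

Section GraphCalculus.
Context {R : realType} {V : finType} (G : weighted_graph R V) (r : R).

Definition inner (u v : V -> R) : R :=
  \sum_i u i * v i * (degree G i `^ r).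

Definition vnorm (u : V -> R) : R := Num.sqrt (inner u u).

Definition laplacian (u : V -> R) : V -> R := fun i =>
  (degree G i `^ (- r)) * \sum_j weight G i j * (u i - u j).

End GraphCalculus.

Section TimeDependent.
Context {R : realType} {V : finType} (G : weighted_graph R V) (r : R).

Local Notation mu := (@lebesgue_measure R).

(* Functions of time are total functions on R; only their values on the set or
   interval given as argument matter. *)
Definition in_L2 (D : set R) (u : R -> V -> R) : Prop :=
  (forall i, measurable_fun D (fun t => u t i)) /\
  (\int[mu]_(t in D) ((vnorm G r (u t)) ^+ 2)%:E < +oo)%E.

(* C_c^oo(D; V -> R), for D open: the test functions are extended by 0. *)
Definition test_function (D : set R) (phi : R -> V -> R) : Prop :=
  (forall (i : V) (n : nat) (t : R),
     derivable (derive1n n (fun s => phi s i)) t 1) /\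
  exists K : set R, [/\ compact K, K `<=` D &
    forall t, ~ K t -> forall i, phi t i = 0].

Definition time_derivative (phi : R -> V -> R) : R -> V -> R :=
  fun t i => derive1 (fun s => phi s i) t.

Definition is_weak_derivative (D : set R) (u w : R -> V -> R) : Prop :=
  forall phi, test_function D phi ->
    \int[mu]_(t in D) inner G r (u t) (time_derivative phi t) =
    - \int[mu]_(t in D) inner G r (w t) (phi t).

Definition in_H1 (D : set R) (u : R -> V -> R) : Prop :=
  in_L2 D u /\ exists w, in_L2 D w /\ is_weak_derivative D u w.

Definition in_H1loc (T : interval R) (u : R -> V -> R) : Prop :=
  forall a b, a \in T -> b \in T -> a < b -> in_H1 `]a, b[%classic u.

(* w represents du/dt on T; it is determined up to a null set. *)
Definition is_weak_derivative_loc (T : interval R) (u w : R -> V -> R) : Prop :=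
  forall a b, a \in T -> b \in T -> a < b ->
    in_L2 `]a, b[%classic w /\ is_weak_derivative `]a, b[%classic u w.

Definition in_C0 (T : interval R) (u : R -> V -> R) : Prop :=
  forall t, t \in T ->
    vnorm G r (u s - u t) @[s --> within [set` T] (nbhs t)] --> (0 : R).

Definition obstacle_set (u : V -> R) : set (V -> R) :=
  [set alpha | forall i,
    [/\ u i = 0 -> 0 <= alpha i,
        0 < u i < 1 -> alpha i = 0 &
        u i = 1 -> alpha i <= 0]].

Definition AC_solution (eps : R) (T : interval R) (u beta : R -> V -> R) : Prop :=
  [/\ forall t, t \in T -> forall i, 0 <= u t i <= 1,
      in_H1loc T u,
      in_C0 T u &
      exists dudt, is_weak_derivative_loc T u dudt /\
        {ae mu, forall t, t \in T ->
           eps *: dudt t + eps *: laplacian G r (u t) + (1 / 2) *: cst 1 - u t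
             = beta t /\
           obstacle_set (u t) (beta t)}].

End TimeDependent.

(* Main.v *)
Require Import Defs.
From mathcomp Require Import all_boot all_order all_algebra.
From mathcomp Require Import all_classical all_reals all_analysis.
From mathcomp Require Import measurable_realfun.
From mathcomp Require Import ring lra.
Import Order.TTheory GRing.Theory Num.Theory.
Import numFieldNormedType.Exports.
Local Open Scope classical_set_scope.
Local Open Scope ring_scope.

(** Write w = u - v.  The obstacle terms act in the right direction: where
    w i > 0, the solution u has left the lower obstacle and v has left the upper
    one, so beta i <= 0 <= gamma i ([obstacle_set_antitone]), and the equation
    bounds the weak derivative of w i there by C * M as soon as w j <= M for all
    j ([velocity_diff_le]).  The graph Laplacian costs no more than the degree,
    which gives the constant C ([growth_rate]).

    A continuous function whose weak derivative is at most c a.e. on ]s, t[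
    satisfies f t - f s <= c * (t - s) ([weak_derivative_le]): test the weak
    derivative against a smooth plateau whose two ramps concentrate at s and t.
    Applying this from the last time at which w i <= 0, and then with u and v
    exchanged, yields |w i t| <= C * M * (t - a) whenever w vanishes at a and
    |w| <= M on [a, t].  On a time step of length 1 / (2 * C) every bound M on
    |w| therefore improves to M / 2; as |w| <= 1 because u and v take values in
    [0, 1], w vanishes on the step, and stepping covers the whole interval
    ([AC_solution_unique]).  This works componentwise in the sup norm, so no
    chain rule for weak derivatives and no Gronwall inequality is involved.

    Once u = v, the difference of the two time derivatives is a weak derivative
    of 0.  At each of its Lebesgue points, testing against plateaus shrinking to
    that point shows that it vanishes ([weak_derivative_cst0]); beta and gamma
    are then given a.e. by the same equation.

    The smooth plateaus are built from exp(-1/x).  To avoid computing higher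
    derivatives, they are taken in a class of functions generated so as to be
    closed under differentiation ([elementary]), whose members are
    automatically smooth. *)

Set Implicit Arguments.
Unset Strict Implicit.

(** * A class of smooth functions with compactly supported members *)

Section Smooth.
Context {R : realType}.

(** The classical flat function exp(-1/x) and its multiples by powers of 1/x;
    the powers are there because the derivatives of exp(-1/x) are linear
    combinations of them. *)
Definition flat (n : nat) (x : R) : R :=
  if 0 < x then x^-1 ^+ n * expR (- x^-1) else 0.

(** Membership is witnessed by a formula, so that the closure under
    differentiation is a plain induction in which each rule of calculus is one
    case.  Smoothness then needs no formula for higher derivatives. *)
Inductive elementary : (R -> R) -> Prop :=
| elementary_flat n : elementary (flat n)
| elementary_cst c : elementary (cst c)
| elementary_affine a b f : elementary f -> elementary (fun x => f (a * x + b))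
| elementary_add f g : elementary f -> elementary g ->
    elementary (fun x => f x + g x)
| elementary_mul f g : elementary f -> elementary g ->
    elementary (fun x => f x * g x)
| elementary_inv f : elementary f -> (forall x, f x != 0) ->
    elementary (fun x => (f x)^-1).

Lemma flat_le0 n x : x <= 0 -> flat n x = 0.
Proof. by rewrite /flat; case: ltgtP. Qed.

Lemma flat_gt0 n x : 0 < x -> 0 < flat n x.
Proof.
by move=> x0; rewrite /flat x0 mulr_gt0 ?expR_gt0// exprn_gt0// invr_gt0.
Qed.

Lemma flat_ge0 n x : 0 <= flat n x.
Proof. by have [/flat_le0->//|/(flat_gt0 n)/ltW] := leP x 0. Qed.

(** From y ^ (n+1) <= (n+1)! * exp y at y = 1/x: a linear bound is what makes the
    difference quotient of [flat n] at 0, which is [flat n.+1], tend to 0. *)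
Lemma flat_le_linear n x : flat n x <= (n.+1)`!%:R * `|x|.
Proof.
have [x0|x0] := leP x 0; first by rewrite flat_le0// mulr_ge0.
have y0 : 0 < x^-1 by rewrite invr_gt0.
have := expR_ge1Dxn n (ltW y0).
rewrite /flat x0 gtr0_norm// expRN.
set y := x^-1 => h.
have f0 : 0 < (n.+1)`!%:R :> R by rewrite ltr0n fact_gt0.
have e0 := expR_gt0 y.
rewrite ler_pdivrMr//.
have -> : x = y^-1 by rewrite invrK.
rewrite mulrAC ler_pdivlMr// -exprSr.
have {h} : y ^+ n.+1 / (n.+1)`!%:R <= expR y by lra.
by rewrite ler_pdivrMr// mulrC.
Qed.

Lemma is_derive_flat (n : nat) (x : R) :
  is_derive x 1 (flat n) (flat n.+2 x - n%:R * flat n.+1 x).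
Proof.
have [x0|x0|->] := ltgtP x 0.
- rewrite !flat_le0 ?ltW// mulr0 subr0.
  apply: (@near_eq_is_derive _ _ _ (cst 0)).
  near=> y; rewrite /= flat_le0//; near: y.
  by apply: filterS (lt_nbhsl x0) => y /ltW.
- have -> : flat n.+2 x - n%:R * flat n.+1 x =
     x^-1 ^+ n * (x^-1 ^+ 2 * expR (- x^-1)) + (- n%:R * x^-1 ^+ n.+1) * expR (- x^-1).
    by rewrite /flat x0 !exprS expr0; ring.
  have dinv : is_derive x 1 (fun y : R => y^-1) (- x^-1 ^+ 2).
    apply: is_derive_eq.
      by apply: (@is_deriveV _ id x 1 1); rewrite ?gt_eqF//.
    by rewrite /= scaler1 exprVn.
  have dexp : is_derive x 1 (expR \o (fun y : R => - y^-1))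
      (x^-1 ^+ 2 * expR (- x^-1)).
    have dneg : is_derive x 1 (fun y : R => - y^-1) (x^-1 ^+ 2).
      by apply: is_derive_eq; rewrite opprK.
    rewrite mulrC.
    exact: (is_derive1_comp (f := expR) (g := fun y => - y^-1)).
  apply: (@near_eq_is_derive _ _ _
    ((fun y => y^-1) ^+ n * (expR \o (fun y : R => - y^-1)))).
    near=> y; rewrite /= /flat ifT//.
      by rewrite /GRing.mul /= fctE.
    near: y; exact: lt_nbhsr.
  apply: is_derive_eq => /=.
  rewrite /GRing.scale /= fctE; case: n => [|n]; first by rewrite expr0; ring.
  by rewrite !exprS /=; ring.
- rewrite !flat_le0// mulr0 subr0.
  have h : h^-1 *: (flat n (h *: 1 + 0) - flat n 0) @[h --> (0 : R)^'] --> (0 : R).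
    apply/cvgrPdist_le => e e0.
    have f0 : 0 < n.+2`!%:R :> R by rewrite ltr0n fact_gt0.
    near=> h.
    have -> : h^-1 *: (flat n (h *: 1 + 0) - flat n 0) = flat n.+1 h.
      rewrite /GRing.scale /= addr0 mulr1 (@flat_le0 n 0)// subr0 /flat.
      by case: ifP; rewrite ?mulr0// exprS mulrA.
    rewrite sub0r normrN ger0_norm ?flat_ge0//.
    rewrite (le_trans (flat_le_linear _ _))// mulrC -ler_pdivlMr//.
    near: h; apply: dnbhs0_le; exact: divr_gt0.
  apply: DeriveDef.
    by apply/cvg_ex; exists 0.
  exact/cvg_lim.
Unshelve. all: by end_near.
Qed.

Lemma elementary_is_derive f : elementary f ->
  exists2 g, elementary g & forall x : R, is_derive x 1 f (g x).
Proof.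
elim=> {f} [n|c|a b f _ [f' ef' df]|f g _ [f' ef' df] _ [g' eg' dg]
  |f g ef [f' ef' df] eg [g' eg' dg]|f ef [f' ef' df] f0].
- exists (fun x => flat n.+2 x + cst (- n%:R) x * flat n.+1 x).
    apply: elementary_add; first exact: elementary_flat.
    apply: elementary_mul; [exact: elementary_cst|exact: elementary_flat].
  move=> x; rewrite /= mulNr; exact: is_derive_flat.
- by exists (cst 0); [exact: elementary_cst|move=> x; exact: is_derive_cst].
- exists (fun x => cst a x * f' (a * x + b)).
    apply: elementary_mul; [exact: elementary_cst|exact: elementary_affine].
  move=> x.
  have daff : is_derive x 1 (fun y => a * y + b) a.
    have -> : (fun y => a * y + b) = (a *: id) + cst b by [].
    by apply: is_derive_eq; rewrite addr0 /GRing.scale /= mulr1.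
  rewrite /= mulrC; exact: (is_derive1_comp (f := f)).
- exists (fun x => f' x + g' x); first exact: elementary_add.
  by move=> x; exact: is_deriveD.
- exists (fun x => f x * g' x + g x * f' x).
    by apply: elementary_add; exact: elementary_mul.
  by move=> x; exact: is_deriveM.
- exists (fun x => cst (-1) x * ((f x)^-1 * (f x)^-1) * f' x).
    apply: elementary_mul => //; apply: elementary_mul; first exact: elementary_cst.
    by apply: elementary_mul; exact: elementary_inv.
  move=> x; have -> : cst (-1) x * ((f x)^-1 * (f x)^-1) * f' x = - f x ^- 2 *: f' x.
    by rewrite /GRing.scale /= mulN1r -invfM -expr2.
  exact: is_deriveV.
Qed.

Lemma elementary_derive1 f : elementary f -> elementary (derive1 f).
Proof.
move=> /elementary_is_derive[g eg dg].
have -> // : derive1 f = g.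
by apply/funext => x; rewrite derive1E; have [] := dg x.
Qed.

Lemma elementary_derivable f x : elementary f -> derivable f x 1.
Proof. by move=> /elementary_is_derive[g _ /(_ x)[]]. Qed.

Lemma elementary_derivable_iter f n x : elementary f ->
  derivable (derive1n n f) x 1.
Proof.
elim: n f => [|n IH] f ef; first exact: elementary_derivable.
rewrite derive1Sn; apply: IH; exact: elementary_derive1.
Qed.

Lemma elementary_continuous f : elementary f -> continuous f.
Proof.
move=> ef x; apply: differentiable_continuous.
by apply/derivable1_diffP; exact: elementary_derivable.
Qed.

(** The smooth transition from 0 on the left of 0 to 1 on the right of 1. *)
Definition step (x : R) : R := flat 0 x * (flat 0 x + flat 0 (1 - x))^-1.

Lemma step_den_gt0 x : 0 < flat 0 x + flat 0 (1 - x).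
Proof.
have [x0|x0] := leP x 0.
  by rewrite ltr_wpDl ?flat_ge0// flat_gt0//; lra.
by rewrite ltr_pwDl ?flat_ge0 ?flat_gt0.
Qed.

Lemma step_le0 x : x <= 0 -> step x = 0.
Proof. by move=> x0; rewrite /step flat_le0// mul0r. Qed.

Lemma step_ge1 x : 1 <= x -> step x = 1.
Proof.
move=> x1; rewrite /step (@flat_le0 _ (1 - x)) ?subr_le0// addr0 mulfV//.
by rewrite gt_eqF// flat_gt0//; lra.
Qed.

Lemma elementary_step : elementary step.
Proof.
have ef : elementary (flat 0) := elementary_flat 0.
have er : elementary (fun x => flat 0 (1 - x)).
  have -> : (fun x => flat 0 (1 - x)) = (fun x => flat 0 (-1 * x + 1)).
    by apply/funext => x; rewrite mulN1r addrC.
  exact: elementary_affine.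
apply: elementary_mul => //.
apply: (@elementary_inv (fun x => flat 0 x + flat 0 (1 - x))).
  exact: elementary_add.
by move=> x; rewrite gt_eqF// step_den_gt0.
Qed.

Lemma step_nondecreasing x y : x <= y -> step x <= step y.
Proof.
have flat_nd a b : a <= b -> flat 0 a <= flat 0 b.
  move=> ab; have [a0|a0] := leP a 0; first by rewrite flat_le0// flat_ge0.
  have b0 := lt_le_trans a0 ab.
  by rewrite /flat a0 b0 !expr0 !mul1r ler_expR lerN2 lef_pV2.
move=> xy; rewrite /step ler_pdivrMr ?step_den_gt0// mulrAC.
rewrite ler_pdivlMr ?step_den_gt0//.
have h1 := flat_nd _ _ xy.
have h2 : flat 0 (1 - y) <= flat 0 (1 - x) by apply: flat_nd; lra.
have := flat_ge0 0 x; have := flat_ge0 0 (1 - y).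
move: h1 h2; nra.
Qed.

Lemma nondecreasing_derive1_ge0 (f : R -> R) (x : R) :
  {homo f : y z / y <= z} -> derivable f x 1 -> 0 <= derive1 f x.
Proof.
move=> ndf dx; rewrite derive1E /derive; apply: limr_ge; first exact: dx.
apply: nearW => h; rewrite /GRing.scale /= mulr1.
have [h0|h0] := leP 0 h.
  by rewrite mulr_ge0 ?invr_ge0// subr_ge0 ndf// lerDr.
apply: mulr_le0; first by rewrite invr_le0 ltW.
by rewrite subr_le0 ndf// gerDr ltW.
Qed.
End Smooth.

(** * Ramps *)

Section Ramp.
Context {R : realType}.
Local Notation mu := (@lebesgue_measure R).

Lemma elementary_sub (f g : R -> R) : elementary f -> elementary g ->
  elementary (fun x => f x - g x).
Proof.
move=> ef eg.
have -> : (fun x => f x - g x) = (fun x => f x + cst (-1) x * g x).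
  by apply/funext => x; rewrite /= mulN1r.
by apply: elementary_add => //; apply: elementary_mul => //; exact: elementary_cst.
Qed.

(** The transition of [step], moved to [p, p + d]; the argument is spelled as an
    affine function a * x + b to fit the rule [elementary_affine]. *)
Definition ramp (p d x : R) : R := step (d^-1 * x + - (d^-1 * p)).

Lemma elementary_ramp p d : elementary (ramp p d).
Proof. exact/elementary_affine/elementary_step. Qed.

Lemma ramp_nondecreasing p d x y : 0 < d -> x <= y -> ramp p d x <= ramp p d y.
Proof.
by move=> d0 xy; rewrite step_nondecreasing// lerD2r ler_pM2l// invr_gt0.
Qed.

Lemma ramp_le p d x : 0 < d -> x <= p -> ramp p d x = 0.
Proof.
by move=> d0 xp; rewrite /ramp step_le0// subr_le0 ler_pM2l// invr_gt0.
Qed.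

Lemma ramp_ge p d x : 0 < d -> p + d <= x -> ramp p d x = 1.
Proof.
move=> d0 xp; rewrite /ramp step_ge1// -mulrBr mulrC ler_pdivlMr// mul1r; lra.
Qed.

Lemma ramp_ge0 (p d x : R) : 0 < d -> 0 <= ramp p d x.
Proof.
move=> d0; rewrite -(@ramp_le p d (Num.min x p))// ?ge_min ?lexx ?orbT//.
by apply: ramp_nondecreasing => //; rewrite ge_min lexx.
Qed.

Lemma ramp_le1 p d x : 0 < d -> ramp p d x <= 1.
Proof.
move=> d0; rewrite -(@ramp_ge p d (Num.max x (p + d)))// ?le_max ?lexx ?orbT//.
by apply: ramp_nondecreasing => //; rewrite le_max lexx.
Qed.

Lemma derive1_ramp_ge0 (p d x : R) : 0 < d -> 0 <= derive1 (ramp p d) x.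
Proof.
move=> d0; apply: nondecreasing_derive1_ge0.
  by move=> y z; exact: ramp_nondecreasing.
exact/elementary_derivable/elementary_ramp.
Qed.

Lemma derive1_ramp_eq0 (p d x : R) : 0 < d -> (x < p) || (p + d < x) ->
  derive1 (ramp p d) x = 0.
Proof.
move=> d0 H; rewrite -(derive1_cst (ramp p d x) x) !derive1E.
apply: near_eq_derive; case/orP: H => H.
  near=> y; rewrite /= !ramp_le//; first exact: ltW.
  by apply/ltW; near: y; exact: lt_nbhsl.
near=> y; rewrite /= !ramp_ge//; first exact: ltW.
by apply/ltW; near: y; exact: lt_nbhsr.
Unshelve. all: by end_near.
Qed.

Lemma derive1_elementary_sub (f g : R -> R) (x : R) : elementary f -> elementary g ->
  derive1 (fun y => f y - g y) x = derive1 f x - derive1 g x.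
Proof.
by move=> ef eg; rewrite !derive1E deriveB//; exact: elementary_derivable.
Qed.

Lemma derive1_elementary_cstM (f : R -> R) (c x : R) : elementary f ->
  derive1 (fun y => cst c y * f y) x = c * derive1 f x.
Proof.
by move=> ef; rewrite !derive1E; apply: deriveZ; exact: elementary_derivable.
Qed.

Lemma integrable_within_continuous (f : R -> R) (s t : R) :
  {within `[s, t], continuous f} -> mu.-integrable `]s, t[ (EFin \o f).
Proof.
move=> cf; apply: (@integrableS _ _ _ mu `[s, t]%classic) => //.
  exact: subset_itv_oo_cc.
by apply: continuous_compact_integrable => //; exact: segment_compact.
Qed.

Lemma elementary_within (f : R -> R) (A : set R) : elementary f ->
  {within A, continuous f}.
Proof. by move=> ef; apply: continuous_subspaceT; exact: elementary_continuous. Qed.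

Lemma elementary_measurable (f : R -> R) (D : set R) : elementary f ->
  measurable_fun D f.
Proof.
move=> ef; apply: measurable_funTS; apply: continuous_measurable_fun.
exact: elementary_continuous.
Qed.

Lemma Rintegral_derive1_elementary (h : R -> R) (s t : R) : s < t -> elementary h ->
  \int[mu]_(x in `]s, t[) derive1 h x = h t - h s.
Proof.
move=> st eh; have ed := elementary_derive1 eh.
rewrite /Rintegral -(@integral_itv_bndoo _ _ _ _ true false); last first.
  by apply/measurable_EFinP; exact: elementary_measurable.
rewrite (@continuous_FTC2 _ _ h)//.
- exact: elementary_within.
- split=> [x _||].
  + exact: elementary_derivable.
  + by apply: cvg_at_right_filter; exact: elementary_continuous.
  + by apply: cvg_at_left_filter; exact: elementary_continuous.
Qed.

End Ramp.

(** * Weak derivatives of functions of one variable *)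

Section Weak.
Context {R : realType}.
Local Notation mu := (@lebesgue_measure R).

(** Tests are restricted to elementary functions supported in [p, q]:
    differences of ramps suffice for every use, and a smaller class of tests is
    a weaker requirement on f and g. *)
Definition weak_derivative (s t : R) (f g : R -> R) : Prop :=
  forall psi p q, elementary psi -> s < p -> q < t ->
    (forall x, ~~ (p < x < q) -> psi x = 0) ->
    \int[mu]_(x in `]s, t[) (f x * derive1 psi x) =
    - \int[mu]_(x in `]s, t[) (g x * psi x).

(** Ramps going up at [p, p + d] and down at [q, q + d] form a plateau. *)
Lemma plateau_eq0 (p q d x : R) : 0 < d -> p <= q ->
  ~~ (p < x < q + d) -> ramp p d x - ramp q d x = 0.
Proof.
move=> d0 pq; rewrite negb_and -!leNgt => /orP[xp|xq].
  by rewrite !ramp_le ?subr0// (le_trans xp).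
by rewrite !ramp_ge ?subrr//; apply: le_trans xq; rewrite lerD2r.
Qed.

Lemma plateau_ge0_le1 (p q d x : R) : 0 < d -> p + d <= q ->
  0 <= ramp p d x - ramp q d x <= 1.
Proof.
move=> d0 pq; have [xq|/ltW qx] := leP x q.
  by rewrite (@ramp_le _ q)// subr0 ramp_ge0//= ramp_le1.
rewrite (@ramp_ge _ p)//; last exact: le_trans qx.
by rewrite subr_ge0 ramp_le1//= gerBl ramp_ge0.
Qed.

Lemma integrableM_elementary (s t : R) (g psi : R -> R) : elementary psi ->
  mu.-integrable `]s, t[ (EFin \o g) ->
  mu.-integrable `]s, t[ (EFin \o (fun x => g x * psi x)).
Proof.
move=> ep ig.
have -> : EFin \o (fun x => g x * psi x) = ((EFin \o g) \* (EFin \o psi))%E.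
  by apply/funext => x; rewrite /= EFinM.
apply: integrableMl => //.
  exact: elementary_measurable.
have /compact_bounded[M [Mr Mpsi]] : compact (psi @` `[s, t]%classic).
  apply: continuous_compact; last exact: segment_compact.
  exact: elementary_within.
exists M; split => // N /Mpsi psiN x /= xst; apply: psiN.
by exists x => //; exact: subset_itv_oo_cc.
Qed.

Lemma ae_impl (P Q : R -> Prop) : (forall x, P x -> Q x) ->
  {ae mu, forall x, P x} -> {ae mu, forall x, Q x}.
Proof.
move=> PQ H.
have F : Filter (nbhs (almost_everywhere mu)) by exact: ae_filter_ringOfSetsType.
by move: H; apply: filterS; exact: PQ.
Qed.

(** The integral of f2 - f1 equals that of its absolute value, hence is
    nonnegative. *)
Lemma le_Rintegral_ae (D : set R) (f1 f2 : R -> R) : measurable D ->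
  mu.-integrable D (EFin \o f1) -> mu.-integrable D (EFin \o f2) ->
  {ae mu, forall x, D x -> f1 x <= f2 x} ->
  \int[mu]_(x in D) f1 x <= \int[mu]_(x in D) f2 x.
Proof.
move=> mD if1 if2 f12; rewrite -subr_ge0 -RintegralB//.
have mf : measurable_fun D (fun x => f2 x - f1 x).
  by apply: measurable_funB; apply/measurable_EFinP;
    [exact: (measurable_int mu if2)|exact: (measurable_int mu if1)].
have -> : \int[mu]_(x in D) (f2 x - f1 x) = \int[mu]_(x in D) `|f2 x - f1 x|.
  congr fine; apply: ae_eq_integral => //.
  - exact/measurable_EFinP.
  - by apply/measurable_EFinP; apply: measurableT_comp.
  - apply: ae_impl f12 => x H Dx; rewrite ger0_norm// subr_ge0; exact: H.
exact: Rintegral_ge0.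
Qed.

(** Test against a plateau psi of height 1 with ramps of width d close to s and
    to t.  Since psi' is a positive unit mass near s minus a positive unit mass
    near t, the integral of f * psi' is f s - f t up to the oscillation of f at
    the endpoints, while it equals minus the integral of g * psi, which is at
    least - c * (t - s) because 0 <= psi <= 1. *)
Lemma weak_derivative_le (s t c : R) (f g : R -> R) : s < t -> 0 <= c ->
  {within `[s, t], continuous f} -> mu.-integrable `]s, t[ (EFin \o g) ->
  weak_derivative s t f g ->
  {ae mu, forall x, s < x < t -> g x <= c} ->
  f t - f s <= c * (t - s).
Proof.
move=> st c0 cf ig wfg gc; apply/ler_addgt0Pr => e e0.
have [_ fs ft] := (continuous_within_itvP f st).1 cf.
have e20 : 0 < e / 2 by rewrite divr_gt0.
have [d1 d10 fs1] : exists2 d1, 0 < d1 & forall x, s < x < s + d1 -> `|f s - f x| <= e / 2.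
  move/cvgrPdist_le : fs => /(_ _ e20) [d /= d0 H]; exists d => // x /andP[sx xd].
  by apply: H => //=; rewrite ltr0_norm ?subr_lt0//; lra.
have [d2 d20 ft2] : exists2 d2, 0 < d2 & forall x, t - d2 < x < t -> `|f t - f x| <= e / 2.
  move/cvgrPdist_le : ft => /(_ _ e20) [d /= d0 H]; exists d => // x /andP[sx xd].
  by apply: H => //=; rewrite gtr0_norm ?subr_gt0//; lra.
(* With d a quarter of m, the supports of the ramps, [s + d, s + 2d] and
   [t - 2d, t - d], are disjoint and within d1 of s and d2 of t. *)
pose m := Num.min (Num.min d1 d2) (t - s).
have m0 : 0 < m by rewrite !lt_min d10 d20 subr_gt0.
have [md1 md2 mts] : [/\ m <= d1, m <= d2 & m <= t - s].
  by rewrite /m !ge_min !lexx ?orbT.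
pose d := m / 4.
have d0 : 0 < d by rewrite divr_gt0.
have dm : m = 4 * d by rewrite /d; lra.
pose p := s + d; pose q := t - 2 * d.
pose psi x := ramp p d x - ramp q d x.
have ep : elementary psi by apply: elementary_sub; exact: elementary_ramp.
have pq : p + d <= q by rewrite /p /q; lra.
have psi01 x : 0 <= psi x <= 1 by exact: plateau_ge0_le1.
(* The derivative of h dominates f * psi' pointwise: on the support of each
   ramp, f is replaced by its extreme admissible value there. *)
pose h x := cst (f s + e / 2) x * ramp p d x - cst (f t - e / 2) x * ramp q d x.
have eh : elementary h.
  by apply: elementary_sub; apply: elementary_mul;
    [exact: elementary_cst|exact: elementary_ramp
    |exact: elementary_cst|exact: elementary_ramp].
have mD : measurable (`]s, t[ : set R) by [].
have igpsi := integrableM_elementary ep ig.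
have lower : \int[mu]_(x in `]s, t[) (g x * psi x) <= c * (t - s).
  have -> : c * (t - s) = \int[mu]_(x in `]s, t[) c.
    by rewrite Rintegral_cst//= lebesgue_measure_itv/= lte_fin st.
  apply: le_Rintegral_ae => //.
    exact: (@integrable_within_continuous _ (cst c)) (elementary_within (elementary_cst c)).
  apply: ae_impl gc => x gx; rewrite /= in_itv/= => /gx gxc.
  have /andP[p0 p1] := psi01 x.
  by rewrite (le_trans (ler_wpM2r p0 gxc))// ler_piMr.
have upper : \int[mu]_(x in `]s, t[) (f x * derive1 psi x) <= f s - f t + e.
  have -> : f s - f t + e = h t - h s.
    rewrite /h /= (@ramp_ge _ p d t)// ?(@ramp_ge _ q d t)// ?(@ramp_le _ p d s)//
      ?(@ramp_le _ q d s)//; rewrite /p /q; lra.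
  rewrite -(Rintegral_derive1_elementary st eh).
  apply: le_Rintegral => //.
  - apply: integrableM_elementary; first exact: elementary_derive1.
    exact: integrable_within_continuous.
  - apply: integrable_within_continuous; apply: elementary_within.
    exact: elementary_derive1.
  - move=> x /=; rewrite in_itv/= => /andP[sx xt].
    rewrite (derive1_elementary_sub x (elementary_ramp p d) (elementary_ramp q d)).
    rewrite (derive1_elementary_sub x
      (elementary_mul (elementary_cst _) (elementary_ramp p d))
      (elementary_mul (elementary_cst _) (elementary_ramp q d))).
    rewrite !derive1_elementary_cstM; [|exact: elementary_ramp..].
    have A0 := derive1_ramp_ge0 p x d0; have B0 := derive1_ramp_ge0 q x d0.
    have AA : 0 <= (f s + e / 2 - f x) * derive1 (ramp p d) x.
      have [/(derive1_ramp_eq0 d0)->|] := boolP ((x < p) || (p + d < x)).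
        by rewrite mulr0.
      rewrite negb_or -!leNgt => /andP[px xp]; apply: mulr_ge0 => //.
      suff /fs1 : s < x < s + d1 by rewrite ler_norml => /andP[? ?]; lra.
      by rewrite sx/=; move: xp; rewrite /p; lra.
    have BB : 0 <= (f x - f t + e / 2) * derive1 (ramp q d) x.
      have [/(derive1_ramp_eq0 d0)->|] := boolP ((x < q) || (q + d < x)).
        by rewrite mulr0.
      rewrite negb_or -!leNgt => /andP[qx xq]; apply: mulr_ge0 => //.
      suff /ft2 : t - d2 < x < t by rewrite ler_norml => /andP[? ?]; lra.
      by rewrite xt andbT; move: qx; rewrite /q; lra.
    move: AA BB; lra.
have := wfg psi p (q + d) ep.
have -> : s < p by rewrite /p; lra.
have -> : q + d < t by rewrite /q; lra.
move=> /(_ isT isT) H.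
have pq' : p <= q by apply: le_trans pq; rewrite lerDl ltW.
have {}H := H (fun x => plateau_eq0 d0 pq').
lra.
Qed.
End Weak.

(** * The weak derivative of zero *)

Section Zero.
Context {R : realType}.
Local Notation mu := (@lebesgue_measure R).

Lemma lebesgue_pt_le (G : R -> R) (x e : R) : 0 < e -> lebesgue_pt G x ->
  \forall r \near 0^'+,
    (\int[mu]_(y in ball x r) `|(G y - G x)%:E| <= (r * e)%:E)%E.
Proof.
move=> e0 lp.
have : \forall r \near 0^'+, (davg G x r < (e / 2)%:E)%E.
  apply: (lp [set y | (y < (e / 2)%:E)%E]).
  apply: open_nbhs_nbhs; split; first exact: open_ereal_lt_ereal.
  by rewrite /= lte_fin divr_gt0.
move=> H; apply: filterS2 H (nbhs_right_gt 0) => r + r0.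
rewrite /davg /iavg (lebesgue_measure_ball _ (ltW r0)).
rewrite inver mulrn_eq0/= gt_eqF// lte_pdivrMl ?mulrn_wgt0//.
move=> /ltW; congr (_ <= _)%E.
by rewrite -EFinM mulr2n; congr EFin; lra.
Qed.

(** At a Lebesgue point x, test against a plateau psi supported in the ball of
    radius r around x.  As the integral of g * psi is 0, g x times the mass of
    psi, which is at least r, is the integral of (g x - g) * psi; this is at most
    the integral of |g - g x| over the ball, which is o(r). *)
Lemma weak_derivative_cst0 (s t : R) (g : R -> R) : s < t ->
  mu.-integrable `]s, t[ (EFin \o g) -> weak_derivative s t (cst 0) g ->
  {ae mu, forall x, s < x < t -> g x = 0}.
Proof.
move=> st ig wg.
pose D := `]s, t[%classic : set R.
have mD : measurable D by exact: measurable_itv.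
pose G := g \_ D.
have locG : locally_integrable setT G by exact: integrable_locally.
apply: ae_impl (lebesgue_differentiation locG) => x lp xst.
have Dx : D x by rewrite /D /= in_itv.
have /andP[sx xt] := xst.
apply/eqP; rewrite -normr_le0; apply/ler_addgt0Pr => e e0; rewrite add0r.
have near_e := lebesgue_pt_le e0 lp.
near (0 : R)^'+ => r.
have r0 : 0 < r by near: r; exact: nbhs_right_gt.
have rs : r < x - s by near: r; apply: nbhs_right_lt; rewrite subr_gt0.
have rt : r < t - x by near: r; apply: nbhs_right_lt; rewrite subr_gt0.
have re : (\int[mu]_(y in ball x r) `|(G y - G x)%:E| <= (r * e)%:E)%E.
  by near: r.
pose d := r / 2; pose p := x - r; pose q := x + d.
have d0 : 0 < d by rewrite divr_gt0.
have rd : r = 2 * d by rewrite /d; lra.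
have pq : p + d <= q by rewrite /p /q /d; lra.
pose psi y := ramp p d y - ramp q d y.
have ep : elementary psi by apply: elementary_sub; exact: elementary_ramp.
have psi01 y : 0 <= psi y <= 1 by exact: plateau_ge0_le1.
have psi0 y : ~~ (p < y < q + d) -> psi y = 0.
  by apply: plateau_eq0 => //; apply: le_trans pq; rewrite lerDl ltW.
have psi1 y : p + d <= y <= q -> psi y = 1.
  by move=> /andP[? ?]; rewrite /psi ramp_ge// ramp_le// subr0.
have ballD : ball x r `<=` D.
  move=> y; rewrite ball_itv /D/= !in_itv/= => /andP[? ?]; apply/andP; split; lra.
have ipsi : mu.-integrable D (EFin \o psi).
  exact: (integrable_within_continuous (elementary_within ep)).
have igpsi := integrableM_elementary ep ig.
have gpsi0 : \int[mu]_(y in D) (g y * psi y) = 0.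
  have sp : s < p by rewrite /p; lra.
  have qt : q + d < t by rewrite /q /d; lra.
  have := wg psi p (q + d) ep sp qt psi0.
  rewrite (_ : \int[mu]_(y in D) (cst 0 y * derive1 psi y) = 0) => [/eqP|].
    by rewrite eq_sym oppr_eq0 => /eqP.
  by rewrite -[RHS](mul0r (fine (mu D))) -Rintegral_cst//; apply: eq_Rintegral => y _; rewrite mul0r.
have igx : mu.-integrable D (EFin \o (fun y => g x * psi y)).
  apply: (@integrable_within_continuous _ (fun y => cst (g x) y * psi y)).
  by apply: elementary_within; apply: elementary_mul => //; exact: elementary_cst.
have idiff : mu.-integrable D (EFin \o (fun y => g x * psi y - g y * psi y)).
  by apply: (@integrableB _ _ _ mu D mD (EFin \o (fun y => g x * psi y))
    (EFin \o (fun y => g y * psi y))).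
have mass : r <= \int[mu]_(y in D) psi y.
  rewrite -lee_fin fineK; last exact: integrable_fin_num ipsi.
  have -> : r%:E = (\int[mu]_(y in ball x d) cst 1%:E y)%E.
    rewrite integral_cst//=; last exact: measurable_ball.
    by rewrite lebesgue_measure_ball ?ltW// mul1e mulr2n; congr EFin; rewrite /d; lra.
  apply: (@le_trans _ _ (\int[mu]_(y in ball x d) (psi y)%:E)%E).
    apply: ge0_le_integral => //=.
    - exact: measurable_ball.
    - by apply/measurable_EFinP; exact: elementary_measurable.
    - move=> y; rewrite ball_itv/= in_itv/= lee_fin => /andP[? ?].
      by rewrite psi1//; apply/andP; split; rewrite /p /q; lra.
  apply: ge0_subset_integral => //=.
  - exact: measurable_ball.
  - by apply/measurable_EFinP; exact: elementary_measurable.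
  - by move=> y _; rewrite lee_fin; case/andP: (psi01 y).
  - apply: subset_trans ballD; apply: le_ball; rewrite /d; lra.
have small : \int[mu]_(y in D) `|g x * psi y - g y * psi y| <= r * e.
  have iabs := integrable_abse idiff.
  rewrite -lee_fin fineK; last exact: integrable_fin_num iabs.
  apply: le_trans re; rewrite -(setIidr ballD) integral_mkcondr.
  apply: ge0_le_integral => //=.
  - exact: (measurable_int mu iabs).
  - apply: measurable_funTS; apply/(measurable_restrictT _ _).1.
      exact: measurable_ball.
    apply: measurable_funTS; apply/measurable_EFinP; apply: measurableT_comp => //.
    by apply: measurable_funB => //; case: locG.
  - move=> y Dy; rewrite patchE; case: ifPn => [yb|].
      rewrite /G !patchE !mem_set// -mulrBl normrM lee_fin.
      have /andP[p0 p1] := psi01 y.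
      by rewrite (ger0_norm p0) distrC ler_piMr.
    rewrite notin_setE ball_itv/= in_itv/= => /negP yb.
    rewrite psi0 ?mulr0 ?subr0 ?normr0//.
    by apply: contra yb; rewrite /p /q /d => /andP[? ?]; apply/andP; split; lra.
rewrite -(ler_pM2r r0) [e * r]mulrC; apply: le_trans small.
apply: (@le_trans _ _ (`|g x| * \int[mu]_(y in D) psi y)).
  by rewrite ler_wpM2l.
rewrite -[X in _ * X]ger0_norm; last exact: le_trans (ltW r0) mass.
rewrite -normrM -RintegralZl//.
rewrite -[X in `|X|]subr0 -gpsi0 -RintegralB//.
exact: le_normr_Rintegral.
Unshelve. all: by end_near.
Qed.
End Zero.

(** * Comparison for weak derivatives *)

Section Comparison.
Context {R : realType}.
Local Notation mu := (@lebesgue_measure R).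

(** Take the supremum of the times at which f <= 0; continuity keeps f <= 0
    there. *)
Lemma continuous_last_nonpos (f : R -> R) (a t : R) :
  {within `[a, t], continuous f} -> a <= t -> f a <= 0 -> 0 < f t ->
  exists s, [/\ a <= s, s < t, f s <= 0 & forall x, s < x < t -> 0 < f x].
Proof.
move=> /subspace_continuousP cf at_ fa ft.
pose A := [set x | a <= x <= t /\ f x <= 0].
have Aa : A a by rewrite /A /= lexx.
have ubA : ubound A t by move=> x [/andP[]].
have supA : has_sup A by split; [exists a|exists t].
pose s := sup A.
have as_ : a <= s by apply: ub_le_sup Aa; exists t.
have st : s <= t by apply: ge_sup => //; exists a.
have fs : f s <= 0.
  rewrite leNgt; apply/negP => fs.
  have sat : `[a, t]%classic s by rewrite /= in_itv/= as_ st.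
  have /cvgrPdist_lt /(_ _ fs) := cf s sat.
  rewrite near_withinE => -[d /= d0 H].
  have [x Ax sx] := sup_adherent d0 supA.
  have xs : x <= s by apply: ub_le_sup Ax; exists t.
  have [xat fx] := Ax.
  have := H x; rewrite /= in_itv/= xat ger0_norm ?subr_ge0// => /(_ _ isT).
  have -> : s - x < d by rewrite -/s in sx; lra.
  move=> /(_ isT); rewrite ltr_norml => /andP[_]. rewrite /from_subspace; lra.
exists s; split => //.
  by rewrite lt_neqAle st andbT; apply: contraTneq ft => <-; rewrite -leNgt.
move=> x /andP[sx xt]; rewrite ltNge; apply/negP => fx.
suff : x <= s by rewrite leNgt sx.
by apply: ub_le_sup; [exists t|split => //; rewrite (ltW xt) andbT (le_trans as_ (ltW sx))].
Qed.

(** The bound on g is only assumed where f > 0: starting from the last time at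
    which f <= 0, it holds all the way to t. *)
Lemma weak_derivative_pos_le (a t c : R) (f g : R -> R) : a <= t -> 0 <= c ->
  {within `[a, t], continuous f} ->
  (forall s, a <= s -> s < t -> mu.-integrable `]s, t[ (EFin \o g)) ->
  (forall s, a <= s -> s < t -> weak_derivative s t f g) ->
  {ae mu, forall x, a < x < t -> 0 < f x -> g x <= c} ->
  f a <= 0 -> f t <= c * (t - a).
Proof.
move=> at_ c0 cf ig wg gc fa.
have [ft|ft] := leP (f t) 0.
  by rewrite (le_trans ft)// mulr_ge0// subr_ge0.
have [s [as_ st fs fpos]] := continuous_last_nonpos cf at_ fa ft.
have cfs : {within `[s, t], continuous f}.
  apply: continuous_subspaceW cf; apply: subset_itvr.
  by rewrite bnd_simp.
have := weak_derivative_le st c0 cfs (ig s as_ st) (wg s as_ st).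
have gc' : {ae mu, forall x, s < x < t -> g x <= c}.
  apply: ae_impl gc => x H /[dup] xst /andP[sx xt].
  by apply: H; [rewrite xt andbT (le_lt_trans as_)|exact: fpos].
move=> /(_ gc') H.
have : c * (t - s) <= c * (t - a) by rewrite ler_wpM2l// lerB.
lra.
Qed.

Lemma weak_derivativeB (s t : R) (f1 f2 g1 g2 : R -> R) :
  {within `[s, t], continuous f1} -> {within `[s, t], continuous f2} ->
  mu.-integrable `]s, t[ (EFin \o g1) -> mu.-integrable `]s, t[ (EFin \o g2) ->
  weak_derivative s t f1 g1 -> weak_derivative s t f2 g2 ->
  weak_derivative s t (fun x => f1 x - f2 x) (fun x => g1 x - g2 x).
Proof.
move=> cf1 cf2 ig1 ig2 w1 w2 psi p q ep sp qt psi0.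
have mD : measurable (`]s, t[ : set R) by [].
under eq_Rintegral do rewrite mulrBl.
rewrite RintegralB//; last 2 first.
- apply: integrableM_elementary; first exact: elementary_derive1.
  exact: integrable_within_continuous.
- apply: integrableM_elementary; first exact: elementary_derive1.
  exact: integrable_within_continuous.
under [in RHS]eq_Rintegral do rewrite mulrBl.
rewrite RintegralB//; [|exact: integrableM_elementary..].
by rewrite (w1 psi p q)// (w2 psi p q)// opprB opprK addrC.
Qed.
End Comparison.

(** * From functions on the vertices to their components *)

Section GraphComponents.
Context {R : realType} {V : finType} (G : weighted_graph R V) (r : R).
Local Notation mu := (@lebesgue_measure R).

Lemma degree_powR_gt0 i : 0 < degree G i `^ r.
Proof. by rewrite powR_gt0// degree_gt0. Qed.

Lemma vnorm_sqr (u : V -> R) : vnorm G r u ^+ 2 = inner G r u u.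
Proof.
rewrite sqr_sqrtr// sumr_ge0// => i _.
by rewrite mulr_ge0 ?powR_ge0// -expr2 sqr_ge0.
Qed.

Lemma sqr_le_vnorm (u : V -> R) i : u i ^+ 2 * degree G i `^ r <= vnorm G r u ^+ 2.
Proof.
rewrite vnorm_sqr /inner (bigD1 i)//= -expr2 lerDl sumr_ge0// => j _.
by rewrite mulr_ge0 ?powR_ge0// -expr2 sqr_ge0.
Qed.

(** On a bounded interval |x| <= 1 + x ^ 2, so that square integrable functions
    are integrable. *)
Lemma in_L2_integrable (s t : R) (u : R -> V -> R) i : 
  in_L2 G r `]s, t[ u -> mu.-integrable `]s, t[ (EFin \o u^~ i).
Proof.
move=> [mu_ ufin].
have mD : measurable (`]s, t[ : set R) by [].
have mn : measurable_fun `]s, t[ (fun x => vnorm G r (u x) ^+ 2).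
  have -> : (fun x => vnorm G r (u x) ^+ 2) = (fun x => inner G r (u x) (u x)).
    by apply/funext => x; rewrite vnorm_sqr.
  apply: measurable_sum => j; apply: measurable_funM => //.
  exact: measurable_funM.
have inorm : mu.-integrable `]s, t[ (EFin \o (fun x => vnorm G r (u x) ^+ 2)).
  apply/integrableP; split; first exact/measurable_EFinP.
  by under eq_integral do rewrite /= ger0_norm ?sqr_ge0//.
have i1 : mu.-integrable `]s, t[ (EFin \o (cst 1 : R -> R)).
  by apply: integrable_within_continuous; apply: elementary_within; exact: elementary_cst.
have iD : mu.-integrable `]s, t[ ((EFin \o (cst 1%R : R -> R)) \+
    (fun x => ((degree G i `^ r)^-1)%:E * (EFin \o (fun x => vnorm G r (u x) ^+ 2)%R) x))%E.
  by apply: integrableD => //; exact: integrableZl.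
apply: le_integrable iD => //; first by apply/measurable_EFinP; exact: mu_.
move=> x _; rewrite /= lee_fin.
apply: le_trans (ler_norm _).
have := sqr_le_vnorm (u x) i.
rewrite -ler_pdivlMr ?degree_powR_gt0// => H.
have : `|u x i| <= 1 + `|u x i| ^+ 2 by nra.
rewrite real_normK ?num_real//; lra.
Qed.

(** Test functions carried by the single vertex i; dividing them by the weight
    d_i ^ r cancels the weight of the inner product. *)
Lemma is_weak_derivative_component (s t : R) (u w : R -> V -> R) i :
  is_weak_derivative G r `]s, t[ u w -> weak_derivative s t (u^~ i) (w^~ i).
Proof.
move=> wd psi p q ep sp qt psi0.
pose c := (degree G i `^ r)^-1.
pose phi (x : R) j := if j == i then cst c x * psi x else 0.
have ephi j : elementary (phi^~ j).
  rewrite /phi; case: eqP => _; last exact: elementary_cst.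
  by apply: elementary_mul => //; exact: elementary_cst.
have tphi : test_function `]s, t[ phi.
  split=> [j n x|].
    by apply: elementary_derivable_iter; exact: ephi.
  exists `[p, q]%classic; split; first exact: segment_compact.
    move=> x /=; rewrite !in_itv/= => /andP[? ?]; apply/andP; split; lra.
  move=> x /negP pxq j; rewrite /phi psi0 ?mulr0 ?if_same//.
  apply: contra pxq; rewrite in_itv/= => /andP[? ?]; apply/andP; split; lra.
have cK : c * degree G i `^ r = 1 by rewrite mulVf// gt_eqF// degree_powR_gt0.
have innerE (a b : V -> R) (y : R) : b i = c * y -> (forall j, j != i -> b j = 0) ->
    inner G r a b = a i * y.
  move=> bi bj; rewrite /inner (bigD1 i)//= big1 ?addr0.
    by rewrite bi -!mulrA [y * _]mulrC (mulrA c) cK mul1r.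
  by move=> j ji; rewrite bj// mulr0 mul0r.
have := wd phi tphi.
congr (_ = - _); apply: eq_Rintegral => x _; apply: innerE.
- rewrite /time_derivative /phi eqxx; exact: derive1_elementary_cstM.
- move=> j ji; rewrite /time_derivative /phi (negbTE ji); exact: derive1_cst.
- by rewrite /phi eqxx.
- by move=> j ji; rewrite /phi (negbTE ji).
Qed.

Lemma in_C0_within (T : interval R) (u : R -> V -> R) (a b : R) i :
  in_C0 G r T u -> `[a, b] `<=` [set` T] ->
  {within `[a, b], continuous (u^~ i)}.
Proof.
move=> cu abT; apply/subspace_continuousP => x xab.
have k0 : 0 < Num.sqrt (degree G i `^ r) by rewrite sqrtr_gt0 degree_powR_gt0.
apply/cvgrPdist_le => e e0.
have /cvgr0Pnorm_le /(_ (e * Num.sqrt (degree G i `^ r)) (mulr_gt0 e0 k0)) := cu x (abT x xab).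
rewrite !near_withinE; apply: filterS => y H yab.
have {}H := H (abT y yab).
rewrite distrC -(ler_pM2r k0); apply: le_trans H.
rewrite [leRHS]ger0_norm ?sqrtr_ge0//.
rewrite -ler_sqr ?nnegrE ?mulr_ge0 ?sqrtr_ge0//.
rewrite exprMn sqr_sqrtr ?powR_ge0// real_normK ?num_real//.
exact: (sqr_le_vnorm (u y - u x) i).
Qed.
End GraphComponents.

(** * Uniqueness for the double-obstacle flow *)

Section Flow.
Context {R : realType} {V : finType} (G : weighted_graph R V) (r eps : R).
Local Notation mu := (@lebesgue_measure R).

(** If y i < x i, then x i > 0 and y i < 1, so that x can only touch the upper
    obstacle and y only the lower one: al i <= 0 <= be i. *)
Lemma obstacle_set_antitone (x y al be : V -> R) i :
  0 <= x i <= 1 -> 0 <= y i <= 1 -> obstacle_set x al -> obstacle_set y be ->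
  y i < x i -> al i <= be i.
Proof.
move=> /andP[_ x1] /andP[y0 _] xal ybe yx.
have [_ x01 xe1] := xal i; have [ye0 y01 _] := ybe i.
have x0 : 0 < x i := le_lt_trans y0 yx.
have y1 : y i < 1 := lt_le_trans yx x1.
apply: (@le_trans _ _ 0).
  move: x1; rewrite le_eqVlt => /predU1P[/xe1//|x1].
  by rewrite x01// x0.
move: y0; rewrite le_eqVlt => /predU1P[/esym/ye0//|y0].
by rewrite y01// y0.
Qed.

Definition growth_rate : R :=
  eps^-1 + \sum_i degree G i `^ (- r) * degree G i.

Lemma growth_rate_gt0 : 0 < eps -> 0 < growth_rate.
Proof.
move=> e0; rewrite ltr_pwDl ?invr_gt0// sumr_ge0// => i _.
by rewrite mulr_ge0 ?powR_ge0// ltW// degree_gt0.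
Qed.

(** At a vertex where x is nonnegative, each difference x i - x j is at least
    - M, and the weights sum to the degree. *)
Lemma laplacian_ge (x : V -> R) (M : R) i :
  0 <= x i -> (forall j, x j <= M) ->
  - (degree G i `^ (- r) * degree G i * M) <= laplacian G r x i.
Proof.
move=> xi0 xM; rewrite /laplacian -mulrA -mulrN ler_wpM2l ?powR_ge0//.
rewrite -mulrN mulr_suml ler_sum// => j _; apply: ler_wpM2l.
  have [/weight_gt0/ltW//|/weight_eq0->//] := boolP (edge G i j).
by have := xM j; lra.
Qed.

Lemma laplacianB (x y : V -> R) i :
  laplacian G r x i - laplacian G r y i = laplacian G r (fun j => x j - y j) i.
Proof.
rewrite /laplacian -mulrBr; congr (_ * _); rewrite -sumrB.
by apply: eq_bigr => j _; ring.
Qed.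

Lemma velocity_diff_le (x y dx dy al be : V -> R) (M : R) i : 0 < eps ->
  (forall j, 0 <= x j <= 1) -> (forall j, 0 <= y j <= 1) ->
  eps *: dx + eps *: laplacian G r x + (1 / 2) *: cst 1 - x = al ->
  eps *: dy + eps *: laplacian G r y + (1 / 2) *: cst 1 - y = be ->
  obstacle_set x al -> obstacle_set y be ->
  (forall j, x j - y j <= M) -> 0 < x i - y i ->
  dx i - dy i <= growth_rate * M.
Proof.
move=> e0 x01 y01 ex ey ox oy xyM xyi.
have abi := obstacle_set_antitone (x01 i) (y01 i) ox oy.
rewrite subr_gt0 in xyi; have {abi} := abi xyi.
rewrite -ex -ey => abi.
have lap := laplacian_ge (x := fun j => x j - y j) (i := i) _ xyM.
rewrite subr_ge0 (ltW xyi) -laplacianB in lap; have {}lap := lap isT.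
have M0 : 0 <= M by have := xyM i; lra.
have di : degree G i `^ (- r) * degree G i <= \sum_j degree G j `^ (- r) * degree G j.
  rewrite (bigD1 i)//= lerDl sumr_ge0// => j _.
  by rewrite mulr_ge0 ?powR_ge0// ltW// degree_gt0.
have diM := ler_wpM2r M0 di.
rewrite /growth_rate mulrDl.
have xyi' : eps^-1 * (x i - y i) <= eps^-1 * M.
  by rewrite ler_wpM2l ?invr_ge0 ?(ltW e0)//; exact: xyM.
have abi' : (dx i - dy i) + (laplacian G r x i - laplacian G r y i) <= eps^-1 * (x i - y i).
  rewrite mulrC ler_pdivlMr// mulrC.
  by move: abi; rewrite !fctE /= /GRing.scale /=; lra.
lra.
Qed.

Lemma weak_derivative_loc_integrable T u du (a b : R) i :
  is_weak_derivative_loc G r T u du -> a \in T -> b \in T -> a < b ->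
  mu.-integrable `]a, b[ (EFin \o du^~ i).
Proof. by move=> wd aT bT /(wd a b aT bT)[/in_L2_integrable + _]; exact. Qed.

Lemma itv_subset (T : interval R) (a b : R) : a \in T -> b \in T ->
  `[a, b] `<=` [set` T].
Proof.
move=> aT bT x /=; rewrite in_itv/= => axb.
exact: (interval_is_interval aT bT axb).
Qed.

Lemma ae_and (P Q : R -> Prop) : {ae mu, forall x, P x} -> {ae mu, forall x, Q x} ->
  {ae mu, forall x, P x /\ Q x}.
Proof.
move=> HP HQ.
have F : Filter (nbhs (almost_everywhere mu)) by exact: ae_filter_ringOfSetsType.
by move: HP HQ; apply: filterS2.
Qed.

(** Applied with (u, v) and with (v, u), this bounds |u - v| on [a, t]; it is
    one-sided because the obstacle terms are only controlled where the
    difference is positive. *)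
Lemma AC_solution_diff_le (T : interval R) (u beta v gamma : R -> V -> R)
    (a t M : R) : 0 < eps ->
  AC_solution G r eps T u beta -> AC_solution G r eps T v gamma ->
  a \in T -> t \in T -> a <= t -> 0 <= M ->
  (forall i, u a i <= v a i) ->
  (forall s i, a <= s <= t -> u s i - v s i <= M) ->
  forall i, u t i - v t i <= growth_rate * M * (t - a).
Proof.
move=> e0 [u01 _ cu [du [wu aeu]]] [v01 _ cv [dv [wv aev]]] aT tT at_ M0 uva uvM i.
have inT s : a <= s <= t -> s \in T.
  by move=> ast; exact: (interval_is_interval aT tT ast).
have cwu s : a <= s -> s < t -> {within `[s, t], continuous (u^~ i)}.
  move=> as_ st; apply: (in_C0_within cu); apply: itv_subset => //.
  by apply: inT; rewrite as_ ltW.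
have cwv s : a <= s -> s < t -> {within `[s, t], continuous (v^~ i)}.
  move=> as_ st; apply: (in_C0_within cv); apply: itv_subset => //.
  by apply: inT; rewrite as_ ltW.
apply: (@weak_derivative_pos_le _ a t _ (fun s => u s i - v s i)
    (fun s => du s i - dv s i)) => //.
- by rewrite mulr_ge0// ltW// growth_rate_gt0.
- have cwu' := in_C0_within (i := i) cu (itv_subset aT tT).
  have cwv' := in_C0_within (i := i) cv (itv_subset aT tT).
  by move=> x; apply: continuousB; [exact: cwu'|exact: cwv'].
- move=> s as_ st; have sT : s \in T by apply: inT; rewrite as_ ltW.
  apply: (@integrableB _ _ _ mu `]s, t[%classic _ (EFin \o du^~ i) (EFin \o dv^~ i)) => //.
    exact: weak_derivative_loc_integrable wu sT tT st.
  exact: weak_derivative_loc_integrable wv sT tT st.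
- move=> s as_ st; have sT : s \in T by apply: inT; rewrite as_ ltW.
  apply: weak_derivativeB; [exact: cwu|exact: cwv|..].
  + exact: weak_derivative_loc_integrable wu sT tT st.
  + exact: weak_derivative_loc_integrable wv sT tT st.
  + by have [_ /is_weak_derivative_component] := wu s t sT tT st; exact.
  + by have [_ /is_weak_derivative_component] := wv s t sT tT st; exact.
- apply: ae_impl (ae_and aeu aev) => x [Hu Hv] /andP[ax xt].
  have axt : a <= x <= t by rewrite !ltW.
  have xT := inT x axt.
  have [eu ou] := Hu xT; have [ev ov] := Hv xT.
  apply: (velocity_diff_le e0 _ _ eu ev ou ov) => //.
  - exact: u01.
  - exact: v01.
  - by move=> j; exact: uvM.
- by rewrite subr_le0.
Qed.

Lemma le_halfpow_eq0 (x : R) : (forall n, `|x| <= 2^-1 ^+ n) -> x = 0.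
Proof.
move=> H; apply/eqP; rewrite -normr_le0 leNgt; apply/negP => x0.
have := H (Num.truncn `|x|^-1).+1; apply/negP; rewrite -ltNge.
rewrite exprVn -[ltRHS]invrK ltf_pV2 ?posrE ?invr_gt0 ?exprn_gt0//.
have xn : `|x|^-1 < (Num.truncn `|x|^-1).+1%:R by exact: truncnS_gt.
by rewrite (lt_trans xn)// -natrX ltr_nat ltn_expl.
Qed.

(** On an interval so short that growth_rate * (t - a) <= 1 / 2, a bound M on
    |u - v| implies the bound M / 2.  Starting from the bound 1, valid since both
    solutions lie between the obstacles, |u - v| <= 2 ^ (- n) for every n. *)
Lemma AC_solution_unique_step (T : interval R) (u beta v gamma : R -> V -> R)
    (a t : R) : 0 < eps ->
  AC_solution G r eps T u beta -> AC_solution G r eps T v gamma ->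
  a \in T -> t \in T -> a <= t -> growth_rate * (t - a) <= 2^-1 ->
  u a = v a -> u t = v t.
Proof.
move=> e0 hu hv aT tT at_ short uva.
have C0 := growth_rate_gt0 e0.
have inT s : a <= s <= t -> s \in T.
  by move=> ast; exact: (interval_is_interval aT tT ast).
have H n : forall s i, a <= s <= t -> `|u s i - v s i| <= 2^-1 ^+ n.
  elim: n => [|n IH] s i /[dup] ast /andP[as_ st].
    have [u01 _ _ _] := hu; have [v01 _ _ _] := hv.
    have /andP[? ?] := u01 s (inT s ast) i; have /andP[? ?] := v01 s (inT s ast) i.
    rewrite expr0 ler_norml; apply/andP; split; lra.
  have sub x : a <= x <= s -> a <= x <= t.
    by move=> /andP[-> xs] /=; exact: le_trans st.
  have M0 : 0 <= 2^-1 ^+ n :> R by rewrite exprn_ge0.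
  have shrink : growth_rate * 2^-1 ^+ n * (s - a) <= 2^-1 ^+ n.+1.
    rewrite exprS mulrAC ler_wpM2r// (le_trans _ short)//.
    by rewrite ler_wpM2l ?(ltW C0)// lerB.
  have sT := inT s ast.
  rewrite ler_norml; apply/andP; split.
    rewrite lerNl opprB (le_trans _ shrink)//.
    apply: (AC_solution_diff_le e0 hv hu) => //.
      by move=> j; rewrite uva.
    by move=> x j /sub /(IH x j); rewrite distrC => /(le_trans (ler_norm _)).
  apply: le_trans shrink.
  apply: (AC_solution_diff_le e0 hu hv) => //.
    by move=> j; rewrite uva.
  by move=> x j /sub /(IH x j) /(le_trans (ler_norm _)).
apply/funext => i; apply/eqP; rewrite -subr_eq0; apply/eqP.
by apply: le_halfpow_eq0 => n; apply: H; rewrite at_ lexx.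
Qed.

Lemma AC_solution_unique (T : interval R) (u beta v gamma : R -> V -> R) :
  0 < eps ->
  AC_solution G r eps T u beta -> AC_solution G r eps T v gamma ->
  0 \in T -> u 0 = v 0 ->
  forall t, t \in T -> 0 <= t -> u t = v t.
Proof.
move=> e0 hu hv T0 uv0.
have C0 := growth_rate_gt0 e0.
pose h := (2 * growth_rate)^-1.
have h0 : 0 < h by rewrite invr_gt0 mulr_gt0.
have Ch : growth_rate * h = 2^-1 by rewrite /h; field; rewrite gt_eqF.
suff H n : forall t, t \in T -> 0 <= t -> t <= n%:R * h -> u t = v t.
  move=> t tT t0; apply: (H (Num.truncn (t / h)).+1) => //.
  by rewrite -ler_pdivrMr// ltW// truncnS_gt.
elim: n => [|n IH] t tT t0 tn.
  by rewrite mul0r in tn; have -> : t = 0 by apply/eqP; rewrite eq_le tn.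
have [tn'|tn'] := leP t (n%:R * h); first exact: IH.
have nh0 : 0 <= n%:R * h by rewrite mulr_ge0// ltW.
have nhT : n%:R * h \in T.
  by apply: (interval_is_interval T0 tT); rewrite nh0 ltW.
apply: (AC_solution_unique_step e0 hu hv nhT) => //.
- exact: ltW.
- rewrite -Ch ler_wpM2l ?(ltW C0)// lerBlDl; move: tn; rewrite -natr1 mulrDl mul1r; lra.
- exact: IH.
Qed.

End Flow.

(** * Uniqueness of the time derivative *)

Section Ae.
Context {R : realType} {V : finType} (G : weighted_graph R V) (r : R).
Local Notation mu := (@lebesgue_measure R).

Lemma ae_neq (c : R) : {ae mu, forall x, x <> c}.
Proof.
exists [set c]; split => //; first exact: lebesgue_measure_set1.
by move=> x /= /contrapT.
Qed.

Lemma weak_derivative_loc_unique (T : interval R) (u v du dv : R -> V -> R)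
    (a b : R) i :
  in_C0 G r T u -> in_C0 G r T v ->
  is_weak_derivative_loc G r T u du -> is_weak_derivative_loc G r T v dv ->
  a \in T -> b \in T -> a < b -> (forall t, t \in T -> u t = v t) ->
  {ae mu, forall t, a < t < b -> du t i = dv t i}.
Proof.
move=> cu cv wu wv aT bT ab uv.
have cwu := in_C0_within (i := i) cu (itv_subset aT bT).
have cwv := in_C0_within (i := i) cv (itv_subset aT bT).
have idu := weak_derivative_loc_integrable i wu aT bT ab.
have idv := weak_derivative_loc_integrable i wv aT bT ab.
have [_ wab] := wu a b aT bT ab; have [_ wab'] := wv a b aT bT ab.
have wui := is_weak_derivative_component i wab.
have wvi := is_weak_derivative_component i wab'.
have wd := weak_derivativeB cwu cwv idu idv wui wvi.
have w0 : weak_derivative a b (cst 0) (fun t => du t i - dv t i).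
  move=> psi p q ep ap qb psi0; rewrite -(wd psi p q ep ap qb psi0).
  apply: eq_Rintegral => t; rewrite inE => tab.
  by rewrite uv ?subrr//; apply: (itv_subset aT bT); exact: subset_itv_oo_cc tab.
have idw : mu.-integrable `]a, b[ (EFin \o (fun t => du t i - dv t i)).
  exact: (@integrableB _ _ _ mu `]a, b[%classic _ (EFin \o du^~ i) (EFin \o dv^~ i)).
apply: ae_impl (weak_derivative_cst0 ab idw w0) => t H /H /eqP.
by rewrite subr_eq0 => /eqP.
Qed.

(** Weak derivatives are only compared on bounded open intervals ]0, b[; up to
    a null set, countably many of them cover T. *)
Lemma interval_exhaustion (T : interval R) :
  (exists T0 : R, 0 < T0 /\ T = `[0, T0]) \/ T = `[0, +oo[ ->
  exists b : nat -> R, (forall n, b n \in T /\ 0 < b n) /\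
    {ae mu, forall t, t \in T -> exists n, 0 < t < b n}.
Proof.
case=> [[T0 [T00 ->]]| ->].
- exists (fun=> T0); split; first by move=> _; rewrite in_itv/= lexx ltW.
  apply: ae_impl (ae_and (ae_neq 0) (ae_neq T0)) => t [t0 tT0].
  rewrite in_itv/= => /andP[t_ge0 t_leT0]; exists 0%N; apply/andP; split.
    by rewrite lt_def t_ge0 andbT; apply/eqP.
  by rewrite lt_neqAle t_leT0 andbT; apply/eqP.
- exists (fun n => n.+1%:R); split; first by move=> n; rewrite in_itv/= andbT ltr0n ler0n.
  apply: ae_impl (ae_neq 0) => t t0; rewrite in_itv/= andbT => t_ge0.
  exists (Num.truncn t); rewrite truncnS_gt andbT lt_def t_ge0 andbT.
  exact/eqP.
Qed.
End Ae.

Unset Implicit Arguments.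

Theorem theorem3p7 (R : realType) (V : finType) (G : weighted_graph R V)
    (r eps : R) (hr : 0 <= r <= 1) (heps : 0 < eps)
    (T : interval R)
    (hT : (exists T0 : R, 0 < T0 /\ T = `[0, T0]) \/ T = `[0, +oo[)
    (u beta v gamma : R -> V -> R)
    (hu : AC_solution G r eps T u beta)
    (hv : AC_solution G r eps T v gamma)
    (h0 : u 0 = v 0) :
  (forall t : R, t \in T -> u t = v t) /\
  {ae (@lebesgue_measure R), forall t, t \in T -> beta t = gamma t}.
Proof.
have T0 : 0 \in T.
  by case: hT => [[T0 [T00 ->]]| ->]; rewrite in_itv/= ?lexx ?(ltW T00).
have T_ge0 t : t \in T -> 0 <= t.
  by case: hT => [[T1 [_ ->]]| ->]; rewrite in_itv/= => /andP[].
have uv t : t \in T -> u t = v t.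
  by move=> tT; exact: (AC_solution_unique heps hu hv T0 h0 tT (T_ge0 t tT)).
split=> //.
have [_ _ cu [du [wu aeu]]] := hu; have [_ _ cv [dv [wv aev]]] := hv.
have [b [bT aeb]] := interval_exhaustion hT.
have aed : {ae (@lebesgue_measure R), forall t,
    forall n i, 0 < t < b n -> du t i = dv t i}.
  apply: ae_foralln => n.
  have F : Filter (nbhs (almost_everywhere (@lebesgue_measure R))).
    exact: ae_filter_ringOfSetsType.
  apply: filter_forall => i; have [bnT bn0] := bT n.
  exact: (weak_derivative_loc_unique i cu cv wu wv).
apply: ae_impl (ae_and (ae_and aeu aev) (ae_and aeb aed)).
move=> t [[Hu Hv] [Hb Hd]] tT.
have [<- _] := Hu tT; have [<- _] := Hv tT; have [n tn] := Hb tT.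
have -> : du t = dv t by apply/funext => i; exact: Hd tn.
by rewrite uv.
Qed.
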